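(* Consider the closed chain of $N$ contours with $2m$ cells and a cluster of $l$ particles on each contour (dynamics in the context). If $N$ is odd and $l\le \frac{m}{N}$, then the system results in a state of free movement from any admissible initial state.
   Context: Closed chain of contours. Integers $N\ge 2$, $m\ge 1$, $1\le l<2m$. Contours are indexed by $i\in\mathbb{Z}/N$ (arithmetic of contour indices is modulo $N$); each contour has $2m$ cells indexed $0,1,\dots,2m-1$ in the direction of movement (arithmetic of cells is modulo $2m$) and one cluster of $l$ particles in consecutive cells. The state $x_i(t)\in\{0,\dots,2m-1\}$ of contour $i$ at time $t$ is the cell of the leading particle of its cluster (cluster $i$); the system state is $(x_0(t),\dots,x_{N-1}(t))$. Contours $i$ and $i+1$ share the node $(i,i+1)$, located between cells $0,1$ of contour $i$ and between cells $m,m+1$ of contour $i+1$. Cluster $i$ occupies node $(i,i+1)$ if $x_i\in\{1,\dots,l-1\}$; cluster $i$ occupies node $(i-1,i)$ if $x_i\in\{m+1,\dots,m+l-1\}$ modulo $2m$. A state is admissible if no node is occupied by two clusters; only admissible states are considered. Dynamics ($t\to t+1$, all clusters simultaneously): $x_i(t+1)=x_i(t)+1 \bmod 2m$ unless cluster $i$ is delayed at time $t$, in which case $x_i(t+1)=x_i(t)$. Cluster $i$ is delayed at time $t$ iff either $x_i(t)=0$ and cluster $i+1$ occupies node $(i,i+1)$; or $x_i(t)=m$ and cluster $i-1$ occupies node $(i-1,i)$; or $x_i(t)=m$ and $x_{i-1}(t)=0$ (left-priority rule). The system is in a state of free movement at time $t_0$ if at every time $t\ge t_0$ every cluster moves without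 delay. ''Results in'' means: reaches such a state at some finite time. *)

(* Defs.v *)
From mathcomp Require Import all_boot.

Set Implicit Arguments.
Unset Strict Implicit.
Unset Printing Implicit Defensive.

(* [x i] is the cell of the leading particle of cluster [i].  The contours
   'I_N and the cells 'I_(2 * m) are cyclically ordered by [ordS]; [x] is an
   arbitrary configuration, admissibility being a separate predicate. *)
Definition state (N m : nat) := {ffun 'I_N -> 'I_(2 * m)}.

(* Node (i, i+1) lies between cells 0 and 1 of contour i. *)
Definition occupies_next (N m l : nat) (x : state N m) (i : 'I_N) : bool :=
  1 <= x i <= l - 1.

(* Node (i-1, i) lies between cells m and m+1 of contour i; the range
   m+1, ..., m+l-1 wraps around modulo 2m when l > m. *)
Definition occupies_prev (N m l : nat) (x : state N m) (i : 'I_N) : bool :=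
  [exists j : 'I_l, (1 <= j) && (x i == (m + j) %% (2 * m) :> nat)].

Definition admissible (N m l : nat) (x : state N m) : Prop :=
  forall i : 'I_N, ~~ (occupies_next l x i && occupies_prev l x (ordS i)).

(* The third case is the left-priority rule. *)
Definition delayed (N m l : nat) (x : state N m) (i : 'I_N) : bool :=
  [|| (x i == 0 :> nat) && occupies_prev l x (ordS i),
      (x i == m :> nat) && occupies_next l x (ord_pred i)
    | (x i == m :> nat) && (x (ord_pred i) == 0 :> nat)].

Definition step (N m l : nat) (x : state N m) : state N m :=
  [ffun i => if delayed l x i then x i else ordS (x i)].

Definition state_at (N m l : nat) (x0 : state N m) (t : nat) : state N m :=
  iter t (@step N m l) x0.

Definition free_movement_at (N m l : nat) (x0 : state N m) (t0 : nat) : Prop :=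
  forall t : nat, t0 <= t -> forall i : 'I_N, ~~ delayed l (state_at l x0 t) i.

Definition results_in_free_movement (N m l : nat) (x0 : state N m) : Prop :=
  exists t0 : nat, free_movement_at l x0 t0.

(* Main.v *)
(* Let e_i in Z/2m be x_(i+1) - x_i - m + l: the node (i, i+1) is in conflict
   iff 0 < e_i < 2l.  A delay of cluster i moves one unit from e_(i-1) to e_i,
   so \sum_i e_i is conserved, and every delay at a node pushes its e_i away
   from the centre l.  Hence the total of max(0, l - |e_i - l|), over all
   nodes, never increases and is eventually constant.  From then on a node
   with e_i outside [0, 2l] is frozen and its two clusters are never delayed;
   going around the ring from it, if cluster i is no longer delayed then each
   delay of cluster i+1 decreases e_i by 1, which happens finitely often.  If
   there is no such node, then no cluster is delayed, because for odd N the sum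
   of the e_i is m + N l modulo 2m, which, as N l <= m, is incompatible with all
   e_i in [0, 2l] and one of them in (0, 2l). *)
Require Import Defs.
From Stdlib Require Import Classical.
From mathcomp Require Import all_boot.
From mathcomp Require Import zify.

Set Implicit Arguments.
Unset Strict Implicit.
Unset Printing Implicit Defensive.

Lemma nonincreasing_eventually_constant (f : nat -> nat) (t0 : nat) :
  (forall t, t0 <= t -> f t.+1 <= f t) ->
  exists2 T, t0 <= T & forall t, T <= t -> f t.+1 = f t.
Proof.
have [n] := ubnP (f t0); elim: n t0 => // n IHn t0 lt_f_n f_dec.
have f_le t : t0 <= t -> f t <= f t0.
  move/subnKC <-; elim: (t - t0) => [|d IHd]; first by rewrite addn0.
  by rewrite addnS; apply: leq_trans (f_dec _ (leq_addr _ _)) IHd.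
case: (classic (exists2 t, t0 <= t & f t.+1 < f t)) => [[t le_t lt_f]|no_drop].
- have [| |T le_T const_f] := IHn t.+1.
  + by have := f_le t le_t; lia.
  + by move=> s le_s; apply: f_dec; lia.
  + by exists T => //; lia.
- exists t0 => // t le_t; apply/eqP; rewrite eqn_leq f_dec //= leqNgt.
  by apply/negP => lt_f; apply: no_drop; exists t.
Qed.

(** Turns a remainder into linear cases for [lia]. The dividend in [gap] stays below 6m, hence the
    factor 3. *)
Lemma modn_eq_bounded (a d : nat) : 0 < d -> a < 3 * d ->
  a %% d < d /\
  (a = a %% d \/ a = a %% d + d \/ a = a %% d + 2 * d).
Proof.
move=> d_gt0 lt_a; have lt_mod := ltn_pmod a d_gt0; split=> //.
have := divn_eq a d; set q := a %/ d; set r := a %% d => def_a.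
have lt_q : q < 3 by rewrite /q ltn_divLR.
by case: q lt_q def_a => [|[|[|]]] // _ def_a; lia.
Qed.

(* [3 * m] stands for [- m] modulo 2m and keeps the subtraction untruncated. *)
Definition gap (N m l : nat) (x : state N m) (i : 'I_N) : nat :=
  (x (ordS i) + 3 * m + l - x i) %% (2 * m).

(** This is max(0, l - |e - l|): truncated subtraction gives 0 once e >= 2l. *)
Definition conflict (l e : nat) : nat := minn e (2 * l - e).

Definition delayed_next (N m l : nat) (x : state N m) (i : 'I_N) : bool :=
  (x i == 0 :> nat) && occupies_prev l x (ordS i).

(** The value 0 of the left cluster is the priority rule; the values 1 to l - 1 are occupation of
    the node. *)
Definition delayed_prev (N m l : nat) (x : state N m) (i : 'I_N) : bool :=
  (x i == m :> nat) && (x (ord_pred i) <= l - 1).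

Lemma delayedE (N m l : nat) (x : state N m) (i : 'I_N) :
  delayed l x i = delayed_next l x i || delayed_prev l x i.
Proof.
rewrite /delayed /delayed_next /delayed_prev /occupies_next; congr (_ || _).
by case: (_ == m :> nat) => //=; lia.
Qed.

Lemma gapP (N m l : nat) (x : state N m) (i : 'I_N) : 0 < m -> 2 * l <= m ->
  gap l x i < 2 * m /\
  (x (ordS i) + 3 * m + l - x i = gap l x i \/
   x (ordS i) + 3 * m + l - x i = gap l x i + 2 * m \/
   x (ordS i) + 3 * m + l - x i = gap l x i + 2 * (2 * m)).
Proof.
move=> m_gt0 le_lm; have := ltn_ord (x (ordS i)) => lt_x.
by apply: modn_eq_bounded; lia.
Qed.

Lemma gap_step (N m l : nat) (x : state N m) (i : 'I_N) :
  0 < m -> 2 * l <= m ->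
  gap l (step l x) i =
    if delayed l x i == delayed l x (ordS i) then gap l x i
    else if delayed l x i then
      (if gap l x i == (2 * m).-1 then 0 else (gap l x i).+1)
    else (if gap l x i == 0 then (2 * m).-1 else (gap l x i).-1).
Proof.
move=> m_gt0 le_lm.
have [lt_g' eq_g'] := gapP (step l x) i m_gt0 le_lm.
have [lt_g eq_g] := gapP x i m_gt0 le_lm.
have succE (y : 'I_(2 * m)) :
    ordS y = (if y.+1 == 2 * m then 0 else y.+1) :> nat.
  rewrite /=; case: eqP => [->|neq]; first by rewrite modnn.
  by rewrite modn_small //; have := ltn_ord y; lia.
have lt_x := ltn_ord (x i); have lt_y := ltn_ord (x (ordS i)).
move: eq_g'; rewrite !ffunE.
case: (delayed l x i); case: (delayed l x (ordS i)); rewrite ?succE //=;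
  do ?case: ifP => ?; lia.
Qed.

(** Here x_i = 0 and x_(i+1) = m + j with 0 < j < l, so the gap is l + j. *)
Lemma delayed_next_gap (N m l : nat) (x : state N m) (i : 'I_N) :
  0 < m -> 2 * l <= m -> delayed_next l x i -> l < gap l x i < 2 * l.
Proof.
move=> m_gt0 le_lm /andP[/eqP xi0 /existsP[j /andP[j_gt0 /eqP]]].
have lt_j := ltn_ord j; rewrite modn_small; last by lia.
have [lt_g eq_g] := gapP x i m_gt0 le_lm.
by move=> xSi; lia.
Qed.

(** Here the gap is l - x_i; the priority case x_i = 0 sits exactly at the centre l. *)
Lemma delayed_prev_gap (N m l : nat) (x : state N m) (i : 'I_N) :
  0 < m -> 0 < l -> 2 * l <= m ->
  delayed_prev l x (ordS i) -> 0 < gap l x i <= l.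
Proof.
move=> m_gt0 l_gt0 le_lm /andP[/eqP xSi]; rewrite ordSK => xi.
have [lt_g eq_g] := gapP x i m_gt0 le_lm.
by lia.
Qed.

Lemma delayed_next_prevF (N m l : nat) (x : state N m) (i : 'I_N) :
  0 < m -> delayed_next l x i -> ~~ delayed_prev l x i.
Proof.
by rewrite /delayed_next /delayed_prev => m_gt0 /andP[/eqP-> _]; lia.
Qed.

(** A delay at this node lowers its conflict by 1 (left side); a delay of one of its clusters at the
    neighbouring node raises it by at most 1 (right side). *)
Lemma conflict_step (N m l : nat) (x : state N m) (i : 'I_N) :
  0 < m -> 0 < l -> 2 * l <= m ->
  conflict l (gap l (step l x) i)
    + (delayed_next l x i + delayed_prev l x (ordS i)) <=
  conflict l (gap l x i)
    + (delayed_next l x (ordS i) + delayed_prev l x i).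
Proof.
move=> m_gt0 l_gt0 le_lm; have [lt_g _] := gapP x i m_gt0 le_lm.
have := @delayed_next_gap _ _ _ x i m_gt0 le_lm.
have := @delayed_prev_gap _ _ _ x i m_gt0 l_gt0 le_lm.
have := @delayed_next_prevF _ _ l x i m_gt0.
have := @delayed_next_prevF _ _ l x (ordS i) m_gt0.
rewrite gap_step // !delayedE /conflict.
case: (delayed_next _ _ i); case: (delayed_next _ _ (ordS i));
  case: (delayed_prev _ _ i); case: (delayed_prev _ _ (ordS i)) => /=;
  do ?case: ifP => ?; lia.
Qed.

Definition total_conflict (N m l : nat) (x : state N m) : nat :=
  \sum_i conflict l (gap l x i).

Lemma sum_ordS (N : nat) (F : 'I_N -> nat) : \sum_i F (ordS i) = \sum_i F i.
Proof. by rewrite [RHS](reindex_inj (@ordS_inj N)). Qed.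

(** The delay terms of [conflict_step] cancel around the ring, and the summed inequality is tight
    only if each summand is. *)
Lemma total_conflict_leqif (N m l : nat) (x : state N m) :
  0 < m -> 0 < l -> 2 * l <= m ->
  total_conflict l (step l x) <= total_conflict l x ?= iff
  [forall i, conflict l (gap l (step l x) i)
               + (delayed_next l x i + delayed_prev l x (ordS i)) ==
             conflict l (gap l x i)
               + (delayed_next l x (ordS i) + delayed_prev l x i)].
Proof.
move=> m_gt0 l_gt0 le_lm.
have : forall i : 'I_N, true -> _ := fun i _ =>
  leqif_eq (conflict_step x i m_gt0 l_gt0 le_lm).
move/leqif_sum; rewrite !big_split /=.
rewrite (sum_ordS (fun i => nat_of_bool (delayed_next l x i))).
rewrite (sum_ordS (fun i => nat_of_bool (delayed_prev l x i))).
by rewrite addnC [X in _ <= X ?= iff _]addnC /leqif leq_add2l eqn_add2l.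
Qed.

(* Equality in the potential estimate at node (i, i+1). *)
Definition stationary_at (N m l : nat) (x : state N m) (i : 'I_N) : Prop :=
  conflict l (gap l (step l x) i)
    + (delayed_next l x i + delayed_prev l x (ordS i)) =
  conflict l (gap l x i)
    + (delayed_next l x (ordS i) + delayed_prev l x i).

(** Beyond 2l a unit move keeps the conflict at 0, so a delay coming from a neighbouring node would
    make the estimate strict. *)
Lemma stationary_far (N m l : nat) (x : state N m) (i : 'I_N) :
  0 < m -> 0 < l -> 2 * l <= m -> stationary_at l x i -> 2 * l < gap l x i ->
  ~~ delayed l x i /\ gap l (step l x) i = gap l x i.
Proof.
move=> m_gt0 l_gt0 le_lm; have [lt_g _] := gapP x i m_gt0 le_lm.
have := @delayed_next_gap _ _ _ x i m_gt0 le_lm.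
have := @delayed_prev_gap _ _ _ x i m_gt0 l_gt0 le_lm.
rewrite /stationary_at gap_step // !delayedE /conflict.
case: (delayed_next _ _ i); case: (delayed_next _ _ (ordS i));
  case: (delayed_prev _ _ i); case: (delayed_prev _ _ (ordS i)) => /=;
  do ?case: ifP => ?; lia.
Qed.

(** Stationarity excludes the wrap from 0 to 2m - 1, where the conflict stays 0 despite a delay. *)
Lemma stationary_drop (N m l : nat) (x : state N m) (i : 'I_N) :
  0 < m -> 0 < l -> 2 * l <= m -> stationary_at l x i -> ~~ delayed l x i ->
  gap l (step l x) i + delayed l x (ordS i) = gap l x i.
Proof.
move=> m_gt0 l_gt0 le_lm; have [lt_g _] := gapP x i m_gt0 le_lm.
have := @delayed_prev_gap _ _ _ x i m_gt0 l_gt0 le_lm.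
rewrite /stationary_at gap_step // !delayedE /conflict.
case: (delayed_next _ _ i); case: (delayed_next _ _ (ordS i));
  case: (delayed_prev _ _ i); case: (delayed_prev _ _ (ordS i)) => /=;
  do ?case: ifP => ?; lia.
Qed.

Lemma all_near_not_delayed (N m l : nat) (x : state N m) :
  0 < m -> 0 < l -> 2 * l <= m -> odd N -> l * N <= m ->
  (forall i, gap l x i <= 2 * l) -> forall i, ~~ delayed l x i.
Proof.
move=> m_gt0 l_gt0 le_lm N_odd le_lNm near i; apply/negP => del_i.
have [j /andP[gap_gt0 gap_lt]] : exists j, 0 < gap l x j < 2 * l.
  move: del_i; rewrite delayedE => /orP[del|].
    by exists i; have := delayed_next_gap m_gt0 le_lm del; lia.
  rewrite -{1}(ord_predK i) => del; exists (ord_pred i).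
  by have := delayed_prev_gap m_gt0 l_gt0 le_lm del; lia.
have sum_gt0 : 0 < \sum_i gap l x i.
  by rewrite (bigD1 j) //=; lia.
have sum_lt : \sum_i gap l x i < 2 * l * N.
  have -> : 2 * l * N = \sum_(i < N) 2 * l.
    by rewrite sum_nat_const card_ord mulnC.
  rewrite (bigD1 j) //= [X in _ < X](bigD1 j) //= -addSn leq_add //.
  exact: leq_sum.
have sum_eq : \sum_i gap l x i = N * (3 * m + l) %[mod 2 * m].
  have -> : \sum_i gap l x i
              = \sum_i (x (ordS i) + 3 * m + l - x i) %[mod 2 * m].
    by rewrite /gap modn_summ.
  suff -> : \sum_i (x (ordS i) + 3 * m + l - x i) = N * (3 * m + l) by [].
  (* Adding the positions back removes the truncated subtraction; they then cancel by cyclic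
     reindexing. *)
  apply: (@addIn (\sum_i (x i : nat))).
  rewrite -big_split.
  transitivity (\sum_i (x (ordS i) + (3 * m + l))).
    apply: eq_bigr => k _; rewrite addnA; apply: subnK.
    by apply: leq_trans (ltnW (ltn_ord _)) _; lia.
  rewrite big_split /= (sum_ordS (fun i => x i : nat)) sum_nat_const card_ord.
  exact: addnC.
have N_eq := odd_double_half N; rewrite N_odd /= in N_eq.
have eq_mod : N * (3 * m + l) = l * N + m %[mod 2 * m].
  (* With N = 2h + 1, 3mN = (1 + 3h)2m + m: oddness leaves the residue m. *)
  have -> : N * (3 * m + l) = (1 + 3 * N./2) * (2 * m) + (l * N + m).
    by move: (N./2) N_eq => h <-; lia.
  by rewrite modnMDl.
move: sum_eq; rewrite eq_mod => /eqP; set s := \sum_i _ in sum_gt0 sum_lt *.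
(* Since 0 < s < 2lN <= lN + m <= 2m, s cannot be congruent to lN + m. *)
have [le_s|lt_s] := leqP s (l * N + m).
  rewrite eq_sym eqn_mod_dvd // => /dvdnP[[|q] def_s]; first by lia.
  by have := leq_pmull (2 * m) (ltn0Sn q); rewrite -def_s; lia.
by lia.
Qed.

Lemma state_atS (N m l : nat) (x0 : state N m) (t : nat) :
  state_at l x0 t.+1 = step l (state_at l x0 t).
Proof. by []. Qed.

Lemma eventually_stationary (N m l : nat) (x0 : state N m) :
  0 < m -> 0 < l -> 2 * l <= m ->
  exists T, forall t, T <= t -> forall i, stationary_at l (state_at l x0 t) i.
Proof.
move=> m_gt0 l_gt0 le_lm.
have [t _|T _ const_T] := @nonincreasing_eventually_constant
  (fun t => total_conflict l (state_at l x0 t)) 0.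
  exact: total_conflict_leqif.
exists T => t /const_T; rewrite state_atS => /eqP.
by rewrite total_conflict_leqif // => /forallP all_eq i; apply/eqP/all_eq.
Qed.

Lemma iter_ordS_surj (N : nat) (k i : 'I_N) :
  exists2 j, j < N & i = iter j (@ordS N) k.
Proof.
have iterE j : iter j (@ordS N) k = (k + j) %% N :> nat.
  elim: j => [|j IHj]; first by rewrite addn0 modn_small.
  by rewrite /= IHj addnS -addn1 modnDml addn1.
exists ((i + (N - k)) %% N); first by rewrite ltn_mod; have := ltn_ord k; lia.
apply: val_inj; rewrite /= iterE modnDmr.
have -> : k + (i + (N - k)) = i + N by have := ltn_ord k; lia.
by rewrite modnDr modn_small.
Qed.

Lemma far_free_movement (N m l : nat) (x0 : state N m) (T : nat) (k : 'I_N) :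
  0 < m -> 0 < l -> 2 * l <= m ->
  (forall t, T <= t -> forall i, stationary_at l (state_at l x0 t) i) ->
  2 * l < gap l (state_at l x0 T) k ->
  results_in_free_movement l x0.
Proof.
move=> m_gt0 l_gt0 le_lm stat far.
have far_t t : T <= t -> 2 * l < gap l (state_at l x0 t) k.
  move/subnKC <-; elim: (t - T) => [|d IHd]; first by rewrite addn0.
  have stat_k := stat (T + d) (leq_addr d T) k.
  rewrite addnS state_atS.
  by case: (stationary_far m_gt0 l_gt0 le_lm stat_k IHd) => _ ->.
(* Induction around the ring from [k]; each new contour may need a later time. *)
suff free_up_to n : exists T', forall t, T' <= t -> forall j, j <= n ->
    ~~ delayed l (state_at l x0 t) (iter j (@ordS N) k).
  have [T' free] := free_up_to N; exists T' => t le_t i.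
  have [j lt_j ->] := iter_ordS_surj k i.
  exact/free/ltnW.
elim: n => [|n [T1 free]].
  exists T => t le_t [|//] _.
  by case: (stationary_far m_gt0 l_gt0 le_lm (stat t le_t k) (far_t t le_t)).
pose i := iter n (@ordS N) k; pose T2 := maxn T T1.
have drop t : T2 <= t -> gap l (state_at l x0 t.+1) i
    + delayed l (state_at l x0 t) (ordS i) = gap l (state_at l x0 t) i.
  rewrite geq_max => /andP[le_T le_T1]; rewrite state_atS.
  by apply: stationary_drop => //; [exact: stat | exact: free].
have [t le_t|T3 le_T3 const] := @nonincreasing_eventually_constant
  (fun t => gap l (state_at l x0 t) i) T2.
  by have := drop t le_t; lia.
exists T3 => t le_t j; rewrite leq_eqVlt ltnS => /predU1P[->|le_j]; last first.
  by apply: free => //; lia.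
have := drop t (leq_trans le_T3 le_t); rewrite const //= -/i.
by case: (delayed _ _ _) => //; lia.
Qed.

Theorem theorem10 (N m l : nat)
    (hN : 2 <= N) (hm : 1 <= m) (hl1 : 1 <= l) (hl2 : l < 2 * m)
    (hodd : odd N) (hlm : l * N <= m)
    (x0 : state N m) (hx0 : admissible l x0) :
  results_in_free_movement l x0.
Proof.
have le_lm : 2 * l <= m.
  by rewrite mulnC; apply: leq_trans hlm; rewrite leq_mul2l hN orbT.
have [T stat] := eventually_stationary x0 hm hl1 le_lm.
have [/existsP[k far]|] := boolP [exists k, 2 * l < gap l (state_at l x0 T) k].
  exact: far_free_movement stat far.
rewrite negb_exists => /forallP not_far; exists T => t le_t.
apply: all_near_not_delayed => //.
(* Without delays all gaps are unchanged, so nearness at [T] persists. *)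
move: le_t => /subnKC <-; elim: (t - T) => [|d near] i.
  by rewrite addn0 leqNgt.
have free := all_near_not_delayed hm hl1 le_lm hodd hlm near.
by rewrite addnS state_atS gap_step // !(negbTE (free _)) eqxx.
Qed.
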